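(* Let $n,k,q$ be positive integers. If $q\geq \lceil n/k\rceil-2$, then $\mathcal{S}(n,q)\leq 2k$. If $k\geq 2$ and $q< \dfrac{n-1}{k-1}-1$, then $\mathcal{S}(n,q)\geq k$.
   Context: Client-Waiter game on a board $X$ with bias $q$ (a positive integer): two players, Client and Waiter, play in turns. In each turn Waiter offers Client a set of at least $1$ and at most $q+1$ unclaimed elements of $X$; Client claims exactly one of the offered elements and Waiter claims all the other offered elements. The game ends when all elements of $X$ have been claimed. When $X=E(G)$ for a graph $G$, Client's graph is the graph on $V(G)$ whose edges are the edges claimed by Client. $\mathcal{S}(n,q)$ denotes the largest integer $s$ such that, in the Client-Waiter game with bias $q$ on $E(K_n)$, Client has a strategy guaranteeing (against any play of Waiter) that at the end of the game his graph contains a star with $s$ edges, i.e. a vertex of degree at least $s$. *)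

(* Defs.v *)
From mathcomp Require Import all_boot all_order all_algebra.
From mathcomp Require Import boolp.

Set Implicit Arguments.
Unset Strict Implicit.
Unset Printing Implicit Defensive.

Section ClientWaiter.
Variables (T : finType) (board : {set T}) (q : nat).

(* The offered set, and the element of it that Client claims. *)
Definition round : Type := ({set T} * T)%type.

Definition unclaimed (h : seq round) : {set T} :=
  board :\: \bigcup_(r <- h) r.1.

Definition client_set (h : seq round) : {set T} :=
  [set x in [seq r.2 | r <- h]].

(* A strategy maps the rounds played so far, in chronological order, and the
   set currently offered to the element claimed by Client. *)
Definition strategy : Type := seq round -> {set T} -> T.

Definition legal_strategy (sigma : strategy) : Prop :=
  forall h (A : {set T}), A != set0 -> sigma h A \in A.

(* The possibly unfinished plays in which Client follows sigma while Waiter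
   makes arbitrary legal offers. *)
Inductive play (sigma : strategy) : seq round -> Prop :=
| play_start : play sigma [::]
| play_round h (A : {set T}) :
    play sigma h ->
    A \subset unclaimed h -> 1 <= #|A| <= q.+1 ->
    play sigma (rcons h (A, sigma h A)).

Definition client_can_force (P : {set T} -> Prop) : Prop :=
  exists2 sigma, legal_strategy sigma &
    forall h, play sigma h -> unclaimed h = set0 -> P (client_set h).

End ClientWaiter.

Definition complete_edges (n : nat) : {set {set 'I_n}} :=
  [set e : {set 'I_n} | #|e| == 2].

Definition degree (n : nat) (G : {set {set 'I_n}}) (v : 'I_n) : nat :=
  #|[set e in G | v \in e]|.

Definition has_star (n s : nat) (G : {set {set 'I_n}}) : Prop :=
  exists v, s <= degree G v.

Definition forces_star (n q s : nat) : Prop :=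
  client_can_force (complete_edges n) q (@has_star n s).

(* The maximum may be taken over s < n because degrees in K_n are at most
   n - 1; star_number_largest below confirms that nothing is lost. *)
Definition star_number (n q : nat) : nat :=
  \max_(s < n | `[< forces_star n q s >]) s.

Lemma complete_play (T : finType) (B : {set T}) q sigma :
  exists2 h, @play T B q sigma h & unclaimed B h = set0.
Proof.
suff H m h : play B q sigma h -> #|unclaimed B h| <= m ->
    exists2 h', play B q sigma h' & unclaimed B h' = set0.
  exact: (H _ [::] (play_start _ _ _) (leqnn _)).
elim: m h => [|m IH] h ph.
  by rewrite leqn0 cards_eq0 => /eqP ?; exists h.
have [E|[x xU]] := set_0Vmem (unclaimed B h); first by exists h.
move=> le; apply: (IH (rcons h ([set x], sigma h [set x]))).
  by apply: play_round => //; rewrite ?sub1set ?cards1.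
rewrite -ltnS; apply: leq_trans le; apply: proper_card.
rewrite /unclaimed -cats1 big_cat big_seq1 /= -setDDl.
by apply: properD1.
Qed.

Lemma client_set_sub (T : finType) (B : {set T}) q sigma h :
  legal_strategy sigma -> @play T B q sigma h -> client_set h \subset B.
Proof.
move=> ls; elim=> [|{}h A _ IH AU /andP[A0 _]].
  by apply/subsetP => x; rewrite inE.
apply/subsetP => x; rewrite inE map_rcons mem_rcons inE => /orP[/eqP->|xh].
  have /(ls h) xA : A != set0 by rewrite -card_gt0.
  by have := subsetP AU _ xA; rewrite inE => /andP[].
by apply: (subsetP IH); rewrite inE.
Qed.

Lemma degree_lt n (G : {set {set 'I_n}}) v :
  G \subset complete_edges n -> degree G v < n.
Proof.
move=> sG; have n_gt0 : 0 < n by apply: leq_ltn_trans (ltn_ord v).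
rewrite -[X in _ < X](prednK n_gt0) ltnS.
have -> : n.-1 = #|[set~ v]| by rewrite cardsC1 card_ord.
apply: leq_trans (leq_imset_card (fun w => [set v; w]) _).
apply: subset_leq_card; apply/subsetP => e; rewrite inE => /andP[/(subsetP sG)].
rewrite inE => /cards2P[x [y [xy ->]]]; rewrite !inE => /orP[]/eqP->.
  by apply/imsetP; exists y; rewrite // !inE eq_sym.
by apply/imsetP; exists x; rewrite ?inE // setUC.
Qed.

Lemma star_number_largest n q : 0 < n ->
  forces_star n q (star_number n q) /\
  forall s, forces_star n q s -> s <= star_number n q.
Proof.
move=> n0; split.
  have f0 : forces_star n q 0.
    exists (fun _ (A : {set {set 'I_n}}) => odflt set0 [pick x in A]).
      move=> _ A /set0Pn[x xA]; case: pickP => //= A0.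
      by have := A0 x; rewrite xA.
    by move=> h _ _; exists (Ordinal n0).
  rewrite /star_number; elim/big_ind: _ => // [s t fs ft|s /asboolP //].
  by rewrite /maxn; case: ifP.
move=> s fs.
have sn : s < n.
  case: (fs) => sigma ls H.
  have [h ph uh] := complete_play (complete_edges n) q sigma.
  have [v sv] := H h ph uh.
  exact: leq_ltn_trans sv (degree_lt v (client_set_sub ls ph)).
rewrite /star_number (bigD1 (Ordinal sn)) /=; first exact: leq_maxl.
exact/asboolP.
Qed.

(* Main.v *)
Require Import Defs.
From mathcomp Require Import all_boot all_order all_algebra.
From mathcomp Require Import zify.

(* Lower bound: each round adds one edge to Client's graph and removes at most
   q+1 edges from the board, so Client ends with average degree at least
   (n-1)/(q+1) > k-1 whatever he plays.
   Upper bound: n <= k(q+2), so the vertices split into k classes of at most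
   q+2 vertices.  Waiter plays separately on the edges inside each class and on
   the edges between each pair of classes, and keeps Client's degrees at most 2
   on every such board; each vertex meets k boards.  The basic strategy is to
   offer all the remaining edges at the current endpoint of a path, which
   moves on to the vertex that Client picks.  It only fails on K_{q+2,q+2},
   where the first vertex has one edge too many to offer: that edge is held
   back and offered together with the fourth vertex of the path. *)

Set Implicit Arguments.
Unset Strict Implicit.
Unset Printing Implicit Defensive.

(** * Positions won by Waiter, and how such positions combine *)

Section WaiterWins.
Variables (T : finType) (q : nat).
Implicit Types (P Q : {set T} -> Prop) (U C D A : {set T}).

(** A derivation is Waiter's strategy tree from the position with unclaimed set [U] and Client's set
    [C], branching over Client's replies; strategies can then be combined by induction on
    derivations. *)
Inductive waiter_wins P U C : Prop :=
| waiter_wins_end : U = set0 -> P C -> waiter_wins P U C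
| waiter_wins_offer A : A \subset U -> 1 <= #|A| <= q.+1 ->
    (forall x, x \in A -> waiter_wins P (U :\: A) (x |: C)) ->
    waiter_wins P U C.

Lemma waiter_wins_frame P Q U C D :
  (forall C', P C' -> Q (C' :|: D)) ->
  waiter_wins P U C -> waiter_wins Q U (C :|: D).
Proof.
move=> PQ; elim=> {U C} [U C U0 PC|U C A AU cA _ IH].
  by apply: waiter_wins_end => //; apply: PQ.
by apply: (waiter_wins_offer AU cA) => x xA; rewrite setUA; apply: IH.
Qed.

(** Waiter alone chooses the offers, so he can exhaust [U] before touching [U']; the leaves of the
    first tree are replaced by trees for [U']. *)
Lemma waiter_wins_seq P Q U U' C :
  [disjoint U & U'] -> (forall D, P D -> waiter_wins Q U' D) ->
  waiter_wins P U C -> waiter_wins Q (U :|: U') C.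
Proof.
move=> dis PQ w; elim: w dis => {U C} [U C -> PC _|U C A AU cA _ IH dis].
  by rewrite set0U; apply: PQ.
apply: (waiter_wins_offer (A := A)) => // [|x xA].
  exact: subset_trans AU (subsetUl _ _).
have -> : (U :|: U') :\: A = (U :\: A) :|: U'.
  have /setDidPl disA : [disjoint U' & A].
    by rewrite disjoint_sym; apply: disjointWl AU dis.
  by rewrite setDUl disA.
by apply: IH => //; apply: disjointWl dis; apply: subsetDl.
Qed.

Lemma waiter_wins_union P1 P2 Q U1 U2 :
  [disjoint U1 & U2] ->
  (forall D1 D2, P1 D1 -> P2 D2 -> Q (D1 :|: D2)) ->
  waiter_wins P1 U1 set0 -> waiter_wins P2 U2 set0 ->
  waiter_wins Q (U1 :|: U2) set0.
Proof.
move=> dis PQ w1 w2; apply: waiter_wins_seq dis _ w1 => D1 PD1.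
rewrite -[D1]set0U; apply: waiter_wins_frame w2 => D2 PD2.
by rewrite setUC; apply: PQ.
Qed.

(** Used to see that a board with no edge at a vertex adds nothing to Client's degree there. *)
Lemma waiter_wins_sub P U C :
  waiter_wins P U C ->
  waiter_wins (fun D => P D /\ D \subset C :|: U) U C.
Proof.
suff H U' C' : waiter_wins P U' C' -> C' :|: U' \subset C :|: U ->
    waiter_wins (fun D => P D /\ D \subset C :|: U) U' C'.
  by move/H; apply.
elim=> {U' C'} [U' C' U0 PC|U' C' A AU cA _ IH] sub.
  apply: waiter_wins_end => //; split=> //.
  exact: subset_trans (subsetUl _ _) sub.
apply: (waiter_wins_offer AU cA) => x xA; apply: IH => //.
apply: subset_trans sub; rewrite -setUA subUset sub1set inE.
by rewrite (subsetP AU) // orbT setUS // subsetDl.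
Qed.

Lemma unclaimed_rcons (B : {set T}) h r :
  unclaimed B (rcons h r) = unclaimed B h :\: r.1.
Proof. by rewrite /unclaimed -cats1 big_cat big_seq1 /= setDDl. Qed.

Lemma client_set_rcons (h : seq (round T)) r :
  client_set (rcons h r) = r.2 |: client_set h.
Proof. by apply/setP => x; rewrite !inE map_rcons mem_rcons inE. Qed.

(** Following in the tree the branch that [sigma] selects yields one finished play, which is enough
    to refute a forcing claim of Client. *)
Lemma waiter_wins_play P (B : {set T}) sigma :
  legal_strategy sigma -> waiter_wins P B set0 ->
  exists2 h, play B q sigma h & unclaimed B h = set0 /\ P (client_set h).
Proof.
move=> legal wB.
suff H U C : waiter_wins P U C -> forall h, play B q sigma h ->
    unclaimed B h = U -> client_set h = C ->
    exists2 h', play B q sigma h' & unclaimed B h' = set0 /\ P (client_set h').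
  apply: (H _ _ wB [::]); first exact: play_start.
    by rewrite /unclaimed big_nil setD0.
  by apply/setP => x; rewrite !inE.
elim=> {U C} [U C U0 PC h ph hU hC|U C A AU cA _ IH h ph hU hC].
  by exists h => //; rewrite hU hC.
have xA : sigma h A \in A.
  by apply: legal; rewrite -card_gt0; case/andP: cA.
apply: (IH _ xA (rcons h (A, sigma h A))).
- by apply: play_round; rewrite ?hU.
- by rewrite unclaimed_rcons hU.
- by rewrite client_set_rcons hC.
Qed.

Lemma client_set_large (B : {set T}) sigma h :
  legal_strategy sigma -> play B q sigma h ->
  #|B :\: unclaimed B h| <= q.+1 * #|client_set h|.
Proof.
move=> legal ph.
(* The inclusion strengthens the induction: it shows that the element claimed in each round is new
   to Client. *)
suff [] : client_set h \subset B :\: unclaimed B h /\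
    #|B :\: unclaimed B h| <= q.+1 * #|client_set h| by [].
elim: ph => {h} [|h A _ [sub le] AU /andP[A0 Aq]].
  by rewrite /unclaimed big_nil setD0 setDv cards0; split=> //.
have xA : sigma h A \in A by apply: legal; rewrite -card_gt0.
have xU := subsetP AU _ xA.
rewrite unclaimed_rcons client_set_rcons /=.
have AB : A \subset B by apply: subset_trans AU (subsetDl _ _).
have -> : B :\: (unclaimed B h :\: A) = (B :\: unclaimed B h) :|: A.
  by rewrite setDDr (setIidPr AB).
split.
  by rewrite subUset sub1set inE xA orbT /= (subset_trans sub) ?subsetUl.
rewrite cardsU1; have -> : sigma h A \notin client_set h.
  by apply/negP => xC; have := subsetP sub _ xC; rewrite inE xU.
apply: leq_trans (leq_card_setU _ _) _.
by rewrite mulnDr muln1 addnC leq_add.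
Qed.

End WaiterWins.

(** * Degrees and the handshake identity *)

Section Degree.
Variable n : nat.
Implicit Types (G H : {set {set 'I_n}}) (e : {set 'I_n}) (v : 'I_n).

Lemma degree_sub G H v : G \subset H -> degree G v <= degree H v.
Proof.
move=> GH; apply: subset_leq_card; apply/subsetP => e.
by rewrite !inE => /andP[/(subsetP GH) -> ->].
Qed.

Lemma degree_proper G H e v :
  G \subset H -> e \in H -> e \notin G -> v \in e -> degree G v < degree H v.
Proof.
move=> GH eH eG ve; apply: proper_card; apply/properP; split.
  by apply/subsetP => f; rewrite !inE => /andP[/(subsetP GH) -> ->].
by exists e; rewrite !inE ?eH ?ve // (negbTE eG).
Qed.

Lemma degreeU G H v : degree (G :|: H) v <= degree G v + degree H v.
Proof.
apply: leq_trans (leq_card_setU _ _); apply: subset_leq_card.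
by apply/subsetP => e; rewrite !inE andb_orl.
Qed.

Lemma degree0 v : degree set0 v = 0.
Proof. by apply: eq_card0 => e; rewrite !inE. Qed.

Lemma degree1 e v : degree [set e] v = (v \in e).
Proof.
rewrite /degree; case ve: (v \in e).
  by apply/eqP/cards1P; exists e; apply/setP => f; rewrite !inE;
     case: eqP => // ->.
by apply: eq_card0 => f; rewrite !inE; case: eqP => // ->; rewrite ve.
Qed.

Lemma degree_gt0P G v :
  reflect (exists2 e, e \in G & v \in e) (0 < degree G v).
Proof.
rewrite card_gt0; apply: (iffP (set0Pn _)) => [[e]|[e eG ve]].
  by rewrite inE => /andP[]; exists e.
by exists e; rewrite inE eG.
Qed.

Lemma edge_other G e v : G \subset complete_edges n -> e \in G -> v \in e ->
  exists2 w, w != v & e = [set v; w].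
Proof.
move=> /subsetP sG /sG; rewrite inE => /cards2P[x [y [xy ->]]].
rewrite !inE => /orP[]/eqP->; first by exists y; rewrite // eq_sym.
by exists x; rewrite // setUC.
Qed.

(** Double counting of incidences: after exchanging the sums, each edge contributes its two ends. *)
Lemma sum_degree G :
  G \subset complete_edges n -> \sum_v degree G v = 2 * #|G|.
Proof.
move=> /subsetP sG; rewrite /degree.
under eq_bigr => v _ do rewrite -sum1_card.
under eq_bigr => v _ do under eq_bigl => e do rewrite inE.
rewrite (exchange_big_dep (mem G)) /=; last by move=> v e _ /andP[].
under eq_bigr => e eG.
  have -> : \sum_(v | (e \in G) && (v \in e)) 1 = 2.
    rewrite sum1_card; have := sG e eG; rewrite inE => /eqP <-.
    by apply: eq_card => v; rewrite unfold_in eG.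
  over.
by rewrite sum_nat_const mulnC.
Qed.

End Degree.

(** * Keeping Client's degrees at most 2 by leading him along paths *)

Section PathStrategy.
Variables (n q : nat).
Implicit Types (U C G : {set {set 'I_n}}) (A B : {set 'I_n}).

(* Only the start of a path needs degree at most [q.+1]: a vertex reached
   later has already lost the edge leading to it. *)
Lemma path_strategy_from U C x :
  U \subset complete_edges n ->
  (forall v, degree C v <= 2) ->
  (forall v, 0 < degree U v -> degree C v <= (v == x)) ->
  (forall e, e \in U -> exists2 v, v \in e & degree U v <= q.+1) ->
  (forall v, degree U v <= q.+2) -> degree U x <= q.+1 ->
  waiter_wins q (fun D => forall v, degree D v <= 2) U C.
Proof.
have [m] := ubnP #|U|; elim: m => // m IH in U C x *.
rewrite ltnS => leU sU degC visited good degU degx.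
have [U0|[e0 e0U]] := set_0Vmem U; first exact: waiter_wins_end.
(* If no edge is left at [x], a new path starts at the low-degree end of a remaining edge. Every
   vertex that still has edges is then untouched by Client. *)
have {x visited degx} [x [x_gt0 visited degx]] : exists x,
    [/\ 0 < degree U x,
        forall v, 0 < degree U v -> degree C v <= (v == x)
      & degree U x <= q.+1].
  have [x0|x_gt0] := posnP (degree U x); last by exists x.
  have [v ve degv] := good e0 e0U.
  exists v; split=> //; first by apply/degree_gt0P; exists e0.
  move=> w w_gt0; apply: leq_trans (visited w w_gt0) _.
  by have [wx|] := eqVneq w x; first by rewrite wx x0 in w_gt0.
apply: (waiter_wins_offer (A := [set e in U | x \in e])).
- by apply/subsetP => e; rewrite inE => /andP[].
- by rewrite degx andbT.
move=> e; rewrite inE => /andP[eU xe].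
have [y yx eE] := edge_other sU eU xe.
set U' := U :\: _; have sU' : U' \subset U by apply: subsetDl.
have ye : y \in e by rewrite eE !inE eqxx orbT.
have eU' : e \notin U' by rewrite !inE eU xe.
have U'x v : 0 < degree U' v -> v != x /\ 0 < degree U v.
  move=> /degree_gt0P[f]; rewrite !inE => /andP[+ fU] vf.
  rewrite fU /= => xf; split; last by apply/degree_gt0P; exists f.
  by apply: contraNneq xf => <-.
have degC' v : degree (e |: C) v <= (v \in e) + degree C v.
  by rewrite -degree1 degreeU.
apply: (IH _ _ y).
- apply: leq_trans leU; apply: proper_card; apply/properP; split=> //.
  by exists e.
- exact: subset_trans sU.
- move=> v; apply: leq_trans (degC' v) _.
  case ve: (v \in e); last exact: degC.
  rewrite (add1n (degree C v)) ltnS.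
  apply: leq_trans (visited v _) (leq_b1 _).
  by apply/degree_gt0P; exists e.
- move=> v /U'x[vx v_gt0]; apply: leq_trans (degC' v) _.
  have := visited v v_gt0; rewrite (negbTE vx) leqn0 => /eqP ->.
  by rewrite addn0 eE !inE (negbTE vx).
- move=> f fU'; have [v vf degv] := good f (subsetP sU' f fU').
  by exists v => //; apply: leq_trans degv; apply: degree_sub.
- by move=> v; apply: leq_trans (degU v); apply: degree_sub.
- rewrite -ltnS; apply: leq_trans (degU y).
  exact: degree_proper sU' eU eU' ye.
Qed.

Lemma path_strategy U :
  U \subset complete_edges n ->
  (forall e, e \in U -> exists2 v, v \in e & degree U v <= q.+1) ->
  (forall v, degree U v <= q.+2) ->
  waiter_wins q (fun D => forall v, degree D v <= 2) U set0.
Proof.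
move=> sU good degU; have [->|[e eU]] := set_0Vmem U.
  by apply: waiter_wins_end => // v; rewrite degree0.
have [x xe degx] := good e eU.
by apply: (path_strategy_from (x := x)) => // v; rewrite degree0.
Qed.

Definition bipartite_edges A B : {set {set 'I_n}} :=
  [set [set a; b] | a in A, b in B].

Lemma bipartite_edgesC A B : bipartite_edges A B = bipartite_edges B A.
Proof.
by apply/setP => e; apply/imset2P/imset2P => -[x y xA yB ->];
   exists y x; rewrite // setUC.
Qed.

Lemma bipartite_edges_sub A B :
  [disjoint A & B] -> bipartite_edges A B \subset complete_edges n.
Proof.
move=> dis; apply/subsetP => _ /imset2P[a b aA bB ->].
rewrite inE cards2; have [ab|//] := eqVneq a b.
by rewrite ab (disjointFl dis bB) in aA.
Qed.

Lemma bipartite_edges_at A B a e : [disjoint A & B] -> a \in A ->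
  e \in bipartite_edges A B -> a \in e -> exists2 b, b \in B & e = [set a; b].
Proof.
move=> dis aA /imset2P[a' b _ bB ->]; rewrite !inE => /orP[]/eqP aE.
  by exists b; rewrite // aE.
by have := disjointFr dis aA; rewrite aE bB.
Qed.

Lemma bipartite_degree A B a :
  [disjoint A & B] -> a \in A -> degree (bipartite_edges A B) a <= #|B|.
Proof.
move=> dis aA; apply: leq_trans (leq_imset_card (fun b => [set a; b]) _).
apply: subset_leq_card; apply/subsetP => e; rewrite inE => /andP[eU ae].
have [b bB ->] := bipartite_edges_at dis aA eU ae.
exact: imset_f.
Qed.

Lemma bipartite_strategy A B :
  [disjoint A & B] -> #|A| <= q.+2 -> #|B| <= q.+2 ->
  waiter_wins q (fun D => forall v, degree D v <= 2) (bipartite_edges A B) set0.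
Proof.
move=> dis cA cB; set U := bipartite_edges A B.
have sU : U \subset complete_edges n := bipartite_edges_sub dis.
have disC : [disjoint B & A] by rewrite disjoint_sym.
have degA a : a \in A -> degree U a <= #|B| := bipartite_degree dis (a:=a).
have degB b : b \in B -> degree U b <= #|A|.
  by rewrite /U bipartite_edgesC; apply: bipartite_degree.
have atA a f : a \in A -> f \in U -> a \in f ->
    exists2 b, b \in B & f = [set a; b] by apply: bipartite_edges_at.
have atB b f : b \in B -> f \in U -> b \in f ->
    exists2 a, a \in A & f = [set b; a].
  by rewrite /U bipartite_edgesC; apply: bipartite_edges_at.
have inU a b : a \in A -> b \in B -> [set a; b] \in U by apply: imset2_f.
have degU v : degree U v <= q.+2.
  have [-> //|/degree_gt0P[f fU]] := posnP (degree U v).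
  have /imset2P[a b aA bB ->] := fU; rewrite !inE => /orP[]/eqP->.
    exact: leq_trans (degA a aA) cB.
  exact: leq_trans (degB b bB) cA.
(* If one side has at most [q.+1] vertices, every edge has an end of degree at most [q.+1] on the
   other side, and the basic strategy applies. *)
have [cB'|B_big] := leqP #|B| q.+1.
  apply: path_strategy => // _ /imset2P[a b aA bB ->].
  by exists a; [rewrite !inE eqxx | apply: leq_trans (degA a aA) cB'].
have [cA'|A_big] := leqP #|A| q.+1.
  apply: path_strategy => // _ /imset2P[a b aA bB ->].
  by exists b; [rewrite !inE eqxx orbT | apply: leq_trans (degB b bB) cA'].
have neqAB a b : a \in A -> b \in B -> (a == b) = false.
  by move=> aA bB; apply: contraTF aA => /eqP ->; rewrite (disjointFl dis bB).
have neqBA a b : a \in A -> b \in B -> (b == a) = false.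
  by move=> aA bB; rewrite eq_sym neqAB.
(* Both sides have [q.+2] vertices.  The path is [a1 b1 a2 b2], and the edge
   [e] held back at [a1] is offered together with the edges at [b2]. *)
have /card_gt0P[a1 a1A] : 0 < #|A| by apply: leq_trans A_big.
have /card_gt0P[b0 b0B] : 0 < #|B| by apply: leq_trans B_big.
pose e := [set a1; b0]; have eU : e \in U by apply: inU.
(* A second vertex on each side keeps the first three offers nonempty. *)
have other (X : {set 'I_n}) x : q.+1 < #|X| -> exists2 y, y \in X & y != x.
  move=> cX; have : 0 < #|X :\ x| by have := cardsD1 x X; lia.
  by case/card_gt0P => y; rewrite !inE => /andP[]; exists y.
have setE (x y z : 'I_n) : [set x; y] = [set x; z] -> y = z.
  move=> E; have : y \in [set x; z] by rewrite -E !inE eqxx orbT.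
  rewrite !inE => /orP[/eqP yx|/eqP //].
  have : z \in [set x; y] by rewrite E !inE eqxx orbT.
  by rewrite !inE yx orbb => /eqP.
pose U1 := U :\: ([set f in U | a1 \in f] :\ e).
apply: (waiter_wins_offer (A := [set f in U | a1 \in f] :\ e)).
- by apply/subsetP => f; rewrite !inE => /and3P[].
- apply/andP; split.
    have [b bB bb0] := other B b0 B_big.
    apply/card_gt0P; exists [set a1; b]; rewrite !inE inU ?eqxx ?andbT //.
    by apply: contraNneq bb0 => /setE ->.
  rewrite -ltnS; apply: leq_trans (degU a1).
  by rewrite /degree [X in _ < X](cardsD1 e) !inE eU eqxx.
rewrite -/U1 => f1; rewrite !inE => /and3P[f1e f1U a1f1].
have [b1 b1B f1E] := atA a1 f1 a1A f1U a1f1.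
have b1b0 : b1 != b0 by apply: contraNneq f1e => b10; rewrite f1E b10.
have b1f1 : b1 \in f1 by rewrite f1E !inE eqxx orbT.
have sU1 : U1 \subset U by apply: subsetDl.
pose U2 := U1 :\: [set f in U1 | b1 \in f].
apply: (waiter_wins_offer (A := [set f in U1 | b1 \in f])).
- by apply/subsetP => f; rewrite inE => /andP[].
- apply/andP; split.
    have [a aA aa1] := other A a1 A_big.
    apply/card_gt0P; exists [set a; b1].
    rewrite !inE inU // eqxx orbT (eq_sym a1 a) (negbTE aa1) neqAB //.
    by rewrite andbF.
  rewrite -ltnS; apply: leq_trans (degU b1).
  by apply: (degree_proper sU1 f1U) => //; rewrite !inE f1e f1U a1f1.
rewrite -/U2 => f2; rewrite inE => /andP[f2U1 b1f2].
have f2U := subsetP sU1 f2 f2U1.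
have [a2 a2A f2E] := atB b1 f2 b1B f2U b1f2.
have a2a1 : a2 != a1.
  apply: contraTneq f2U1 => a21; have -> : f2 = f1 by rewrite f2E f1E a21 setUC.
  by rewrite !inE f1e f1U a1f1.
have a2f2 : a2 \in f2 by rewrite f2E !inE eqxx orbT.
have sU2 : U2 \subset U1 by apply: subsetDl.
pose U3 := U2 :\: [set f in U2 | a2 \in f].
apply: (waiter_wins_offer (A := [set f in U2 | a2 \in f])).
- by apply/subsetP => f; rewrite inE => /andP[].
- apply/andP; split.
    have [b bB bb1] := other B b1 B_big.
    apply/card_gt0P; exists [set a2; b].
    rewrite !inE inU // eqxx (eq_sym a1 a2) (negbTE a2a1) neqAB //.
    by rewrite (eq_sym b1 b) (negbTE bb1) neqBA // !andbF.
  rewrite -ltnS; apply: leq_trans (degU a2).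
  apply: (degree_proper (subset_trans sU2 sU1) f2U) => //.
  by rewrite in_setD inE f2U1 b1f2.
rewrite -/U3 => f3; rewrite inE => /andP[f3U2 a2f3].
have f3U1 := subsetP sU2 f3 f3U2.
have f3U := subsetP sU1 f3 f3U1.
have [b2 b2B f3E] := atA a2 f3 a2A f3U a2f3.
have b2b1 : b2 != b1.
  apply: contraTneq f3U2 => b21; have -> : f3 = f2 by rewrite f3E f2E b21 setUC.
  by rewrite in_setD inE f2U1 b1f2.
have b2f3 : b2 \in f3 by rewrite f3E !inE eqxx orbT.
have sU3 : U3 \subset U2 by apply: subsetDl.
have b1e : b1 \notin e by rewrite !inE neqBA.
have a2e : a2 \notin e by rewrite !inE negb_or a2a1 neqAB.
have eU3 : e \in U3.
  have eU1 : e \in U1 by rewrite !inE eU eqxx.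
  have eU2 : e \in U2 by rewrite in_setD inE (negbTE b1e) andbF.
  by rewrite in_setD inE (negbTE a2e) andbF.
have f3U3 : f3 \notin U3 by rewrite in_setD inE f3U2 a2f3.
pose O4 := e |: [set f in U3 | b2 \in f].
pose U4 := U3 :\: O4.
have sU4 : U4 \subset U3 by apply: subsetDl.
have sU4U : U4 \subset U.
  exact: subset_trans (subset_trans sU4 sU3) (subset_trans sU2 sU1).
apply: (waiter_wins_offer (A := O4)).
- by rewrite subUset sub1set eU3; apply/subsetP => f; rewrite inE => /andP[].
- rewrite cardsU1 inE eU3 /= -/(degree U3 b2) addn_gt0.
  have lt31 : degree U3 b2 < degree U1 b2.
    exact: degree_proper (subset_trans sU3 sU2) f3U1 f3U3 b2f3.
  (* If [b2] lies on [e], then [e] is already counted at [b2], which has lost [f3]. Otherwise [b2]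
     has lost both [f3] and its edge to [a1], so at most [q] edges remain there and [e] fits in. *)
  case b2e: (b2 \in e); rewrite /= ?add0n ?add1n.
    have -> : 0 < degree U3 b2 by apply/degree_gt0P; exists e.
    rewrite -ltnS (leq_trans lt31) // (leq_trans _ (degU b2)) //.
    exact: degree_sub.
  apply: leq_trans lt31 _; rewrite -ltnS; apply: leq_trans (degU b2).
  apply: (degree_proper (e := [set a1; b2])); rewrite ?inU //.
    have /negbTE a1b2e : [set a1; b2] != e.
      by apply: contraFneq b2e => E; rewrite -E !inE eqxx orbT.
    by rewrite !inE a1b2e inU // eqxx.
  by rewrite !inE eqxx orbT.
move=> f fO4; rewrite -/U4.
have fU3 : f \in U3.
  by have := fO4; rewrite !in_setU1 inE => /orP[/eqP->|/andP[]].
have fU2 := subsetP sU3 f fU3; have fU1 := subsetP sU2 f fU2.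
have fU := subsetP sU1 f fU1.
have fU4 : f \notin U4 by rewrite in_setD fO4.
have b1f : b1 \notin f by have := fU2; rewrite in_setD inE fU1 andbT.
have a2f : a2 \notin f by have := fU3; rewrite in_setD inE fU2 andbT.
have claimed g : g \in U4 ->
    [/\ a1 \notin g, b1 \notin g, a2 \notin g & b2 \notin g].
  rewrite in_setD in_setU1 negb_or => /andP[/andP[ge gb2] gU3].
  have gU2 := subsetP sU3 g gU3; have gU1 := subsetP sU2 g gU2.
  have gU := subsetP sU1 g gU1.
  split; first by have := gU1; rewrite in_setD in_setD1 ge inE gU andbT.
  - by have := gU2; rewrite in_setD inE gU1 andbT.
  - by have := gU3; rewrite in_setD inE gU2 andbT.
  - by have := gb2; rewrite inE gU3.
(* [y] is the new endpoint. *)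
have [y yf endf] : exists2 y, y \in f &
    forall v, v \in f -> [|| v == y, v == a1 | v == b2].
  have := fO4; rewrite in_setU1 inE fU3 => /orP[/eqP->|b2f].
    exists b0 => [|v]; rewrite !inE ?eqxx ?orbT //.
    by case/orP=> ->; rewrite ?orbT.
  have [a aA ->] := atB b2 f b2B fU b2f.
  exists a => [|v]; rewrite !inE ?eqxx ?orbT //.
  by case/orP=> ->; rewrite ?orbT.
set C4 := f |: _.
have degC4 v : degree C4 v <=
    (v \in f) + ((v \in f3) + ((v \in f2) + (v \in f1))).
  rewrite /C4 setU0 -!degree1.
  by do 3!(apply: leq_trans (degreeU _ _ _) _; rewrite leq_add2l).
apply: (path_strategy_from (x := y)) => //.
- exact: subset_trans sU.
(* The vertices [b1] and [a2] already have two path edges, and [f] avoids both; [a1] and [b2] have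
   one each, so [f] brings them to at most 2. *)
- move=> v; apply: leq_trans (degC4 v) _; rewrite f1E f2E f3E !inE.
  have [->|va1] := eqVneq v a1.
    by rewrite (eq_sym a1 a2) (negbTE a2a1) !neqAB //; case: (_ \in f).
  have [->|vb1] := eqVneq v b1.
    by rewrite (negbTE b1f) (eq_sym b1 b2) (negbTE b2b1) neqBA.
  have [->|va2] := eqVneq v a2; first by rewrite (negbTE a2f).
  by case: (_ \in f); case: (v == b2).
- move=> v /degree_gt0P[g /claimed[a1g b1g a2g b2g] vg].
  have neq w : w \notin g -> (v == w) = false.
    by move=> wg; apply: contraNF wg => /eqP <-.
  apply: leq_trans (degC4 v) _; rewrite f1E f2E f3E !inE
    (neq _ a1g) (neq _ b1g) (neq _ a2g) (neq _ b2g).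
  have := endf v; rewrite (neq _ a1g) (neq _ b2g) !orbF.
  by case: (v \in f) => // ->.
(* All edges at [a1] are gone, so each vertex of [B] has lost one and can serve as the low-degree
   end. *)
- move=> g gU4; have /imset2P[a b aA bB gE] := subsetP sU4U g gU4.
  exists b; first by rewrite gE !inE eqxx orbT.
  rewrite -ltnS; apply: leq_trans (degU b).
  apply: (degree_proper sU4U (inU _ _ a1A bB)).
    by apply/negP => /claimed[/negP[]]; rewrite !inE eqxx.
  by rewrite !inE eqxx orbT.
- by move=> v; apply: leq_trans (degU v); apply: degree_sub.
- rewrite -ltnS; apply: leq_trans (degU y).
  exact: degree_proper fU fU4 yf.
Qed.

End PathStrategy.

(** * Splitting the complete graph into boards by vertex colours *)

Section ColourClasses.
Variables (n k q : nat) (c : 'I_n -> 'I_k).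
Hypothesis class_small : forall s, #|[set i | c i == s]| <= q.+2.

(** A singleton [S] gives the edges inside one class, a pair the edges between two classes, any
    other [S] the empty board. Indexing by colour sets puts each edge on exactly one board. *)
Definition colour_edges (S : {set 'I_k}) : {set {set 'I_n}} :=
  [set e in complete_edges n | c @: e == S].

Lemma colour_edges_sub S : colour_edges S \subset complete_edges n.
Proof. by apply/subsetP => e; rewrite inE => /andP[]. Qed.

Lemma colour_edges_strategy S :
  waiter_wins q (fun D => forall v, degree D v <= 2) (colour_edges S) set0.
Proof.
have [->|[e]] := set_0Vmem (colour_edges S).
  by apply: waiter_wins_end => // v; rewrite degree0.
rewrite !inE => /andP[/cards2P[x [y [xy ->]]]].
rewrite imsetU1 imset_set1 => /eqP <-.
have sub := colour_edges_sub [set c x; c y].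
have [cxy|cxy] := eqVneq (c x) (c y).
  (* Inside one class, [v] has at most [q.+2] minus itself as neighbours, so every vertex is a valid
     start of a path. *)
  have deg v : degree (colour_edges [set c x; c y]) v <= q.+1.
    have [-> //|/degree_gt0P[f fU vf]] :=
      posnP (degree (colour_edges [set c x; c y]) v).
    have colour g w : g \in colour_edges [set c x; c y] -> w \in g -> c w = c y.
      rewrite inE cxy setUid => /andP[_ /eqP gE] wg.
      by apply/set1P; rewrite -gE imset_f.
    rewrite -ltnS; apply: leq_trans (class_small (c y)).
    rewrite (cardsD1 v) inE (colour f v fU vf) eqxx add1n ltnS.
    apply: leq_trans (leq_imset_card (fun w => [set v; w]) _).
    apply: subset_leq_card; apply/subsetP => g; rewrite inE => /andP[gU vg].
    have [w wv gE] := edge_other sub gU vg.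
    have wg : w \in g by rewrite gE !inE eqxx orbT.
    by apply/imsetP; exists w => //; rewrite !inE wv (colour g w gU wg) eqxx.
  apply: path_strategy => // [g gU|v]; last exact: leqW.
  have := subsetP sub g gU; rewrite inE => /cards2P[v [w [_ ->]]].
  by exists v; rewrite // !inE eqxx.
have dis : [disjoint [set i | c i == c x] & [set i | c i == c y]].
  rewrite disjoints_subset; apply/subsetP => i; rewrite !inE => /eqP->.
  by rewrite cxy.
suff -> : colour_edges [set c x; c y] =
    bipartite_edges [set i | c i == c x] [set i | c i == c y].
  exact: bipartite_strategy.
apply/eqP; rewrite eqEsubset; apply/andP; split; last first.
  apply/subsetP => g gB; rewrite inE (subsetP (bipartite_edges_sub dis)) //=.
  have /imset2P[a b] := gB; rewrite !inE => /eqP ca /eqP cb ->.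
  by rewrite imsetU1 imset_set1 ca cb.
apply/subsetP => g gU; have := gU.
rewrite !inE => /andP[/cards2P[v [w [vw ->]]]]; rewrite imsetU1 imset_set1.
move=> /eqP E; have : c v \in [set c x; c y] by rewrite -E !inE eqxx.
have : c w \in [set c x; c y] by rewrite -E !inE eqxx orbT.
have : c x \in [set c v; c w] by rewrite E !inE eqxx.
have : c y \in [set c v; c w] by rewrite E !inE eqxx orbT.
rewrite !inE => cy cx cw /orP[cv|cv].
  apply/imset2P; exists v w; rewrite ?inE //; move: cy.
  by rewrite (eqP cv) eq_sym (negbTE cxy) eq_sym.
rewrite setUC; apply/imset2P; exists w v; rewrite ?inE //; move: cx.
by rewrite (eqP cv) (negbTE cxy) eq_sym.
Qed.

(* An edge of [colour_edges S] at [v] forces [S = [set c v; t]] for some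
   colour [t], so at most [k] of the [2 ^ k] boards meet [v]. *)
Lemma card_colour_edges_at v :
  #|[set S | 0 < degree (colour_edges S) v]| <= k.
Proof.
rewrite -[X in _ <= X]card_ord -cardsT.
apply: leq_trans (leq_imset_card (fun t => [set c v; t]) _).
apply: subset_leq_card; apply/subsetP => S; rewrite inE.
move=> /degree_gt0P[e eS ve].
have [w _ eE] := edge_other (colour_edges_sub S) eS ve.
move: eS; rewrite inE eE imsetU1 imset_set1 => /andP[_ /eqP <-].
exact: imset_f.
Qed.

Lemma complete_strategy :
  waiter_wins q (fun D => forall v, degree D v <= 2 * k)
    (complete_edges n) set0.
Proof.
(* The boards are played one after another. The bound charges 2 only to boards that meet [v], since
   the list will run over all subsets of the colours. *)
have H (r : seq {set 'I_k}) : uniq r ->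
    waiter_wins q
      (fun D => forall v,
         degree D v <= \sum_(S <- r) 2 * (0 < degree (colour_edges S) v))
      (\bigcup_(S <- r) colour_edges S) set0.
  elim: r => [_|S r IH /=/andP[Sr ur]].
    by rewrite big_nil; apply: waiter_wins_end => // v; rewrite degree0.
  rewrite big_cons.
  apply: waiter_wins_union (waiter_wins_sub (colour_edges_strategy S)) (IH ur).
    rewrite disjoint_sym disjoints_subset bigcup_seq.
    apply/bigcupsP => S' S'r; apply/subsetP => e.
    rewrite !inE => /andP[-> /eqP ->] /=.
    by apply: contraNneq Sr => <-.
  move=> D1 D2 [D1_le2 D1S] D2_le v; rewrite big_cons.
  apply: leq_trans (degreeU _ _ _) (leq_add _ (D2_le v)).
  have := degree_sub v D1S; rewrite set0U.
  case: posnP => [-> //|_ _]; exact: D1_le2.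
have E : \bigcup_(S <- index_enum {set 'I_k}) colour_edges S = complete_edges n.
  apply/setP => e; apply/bigcupP/idP => [[S _]|eK].
    by rewrite inE => /andP[].
  by exists (c @: e); rewrite // inE eK eqxx.
rewrite -E -[X in waiter_wins _ _ _ X]setU0.
apply: waiter_wins_frame (H _ (index_enum_uniq _)) => D degD v.
rewrite setU0; apply: leq_trans (degD v) _.
rewrite -big_distrr leq_mul2l /= -big_mkcond /=.
rewrite sum1_card; apply: leq_trans (card_colour_edges_at v).
by apply: subset_leq_card; apply/subsetP => S; rewrite inE.
Qed.

End ColourClasses.

(** * The two bounds on the star number *)

Lemma forces_star_ub n k q s :
  n <= k * q.+2 -> forces_star n q s -> s <= 2 * k.
Proof.
move=> nk [sigma legal force].
have lt_k (i : 'I_n) : i %/ q.+2 < k.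
  by rewrite ltn_divLR // (leq_trans (ltn_ord i)).
(* The classes are blocks of [q.+2] consecutive vertices; within a block the remainder modulo [q.+2]
   is injective. *)
pose c i := Ordinal (lt_k i).
have class_small s' : #|[set i | c i == s']| <= q.+2.
  pose f (i : 'I_n) : 'I_q.+2 := inord (i %% q.+2).
  rewrite -[X in _ <= X]card_ord -(card_in_imset (f := f)) ?max_card //.
  move=> i j; rewrite !inE => /eqP ci /eqP cj /(congr1 val).
  rewrite /= !inordK ?ltn_pmod // => ij; apply: val_inj.
  rewrite /= (divn_eq i q.+2) (divn_eq j q.+2) ij.
  by have /(congr1 val) /= -> : c i = c j by rewrite ci.
have [h ph [uh deg]] := waiter_wins_play legal (complete_strategy class_small).
by have [v sv] := force h ph uh; apply: leq_trans sv (deg v).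
Qed.

Lemma forces_star_lb n k q :
  0 < k -> q.+1 * k.-1 < n.-1 -> forces_star n q k.
Proof.
move=> k0 lt_n.
(* Any legal strategy works; the default [set0] is returned only on an empty offer. *)
pose sigma : strategy {set 'I_n} := fun _ A => odflt set0 [pick x in A].
have legal : legal_strategy sigma.
  move=> h A /set0Pn[x xA]; rewrite /sigma.
  by case: pickP => //= /(_ x); rewrite xA.
exists sigma => // h ph uh.
have large := client_set_large legal ph.
have sub := client_set_sub legal ph.
rewrite uh setD0 in large.
have [v kv|deg] := pickP (fun v => k <= degree (client_set h) v).
  by exists v.
have degle v : degree (client_set h) v <= k.-1.
  by rewrite -ltnS prednK // ltnNge deg.
have : 2 * #|client_set h| <= n * k.-1.
  rewrite -sum_degree //; apply: (@leq_trans (\sum_(v < n) k.-1)).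
    by apply: leq_sum => v _.
  by rewrite sum_nat_const card_ord.
(* With m Client edges, n(n-1)/2 <= (q+1)m and 2m <= n(k-1), so n(n-1) <= (q+1)(k-1)n, against
   [lt_n]. *)
have : #|complete_edges n| = 'C(n, 2).
  by rewrite -[n in RHS]card_ord -card_draws; apply: eq_card => e; rewrite !inE.
have := bin2 n; have := mul_bin_diag n 1; rewrite bin1.
nia.
Qed.

Theorem proposition1p1 (n k q : nat) (hn : 0 < n) (hk : 0 < k) (hq : 0 < q) :
  ((Num.ceil (n%:R / k%:R : rat) - 2 <= q%:Z)%R -> star_number n q <= 2 * k) /\
  (2 <= k -> (q%:R < (n%:R - 1) / (k%:R - 1) - 1 :> rat)%R ->
     k <= star_number n q).
Proof.
have [force_star_number star_number_max] := star_number_largest q hn.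
split=> [hceil|k2 hlt].
  apply: forces_star_ub force_star_number.
  have le_q : (n%:R / k%:R <= q.+2%:R :> rat)%R.
    apply: Order.POrderTheory.le_trans (Num.Theory.ceil_ge _) _.
    have -> : (q.+2%:R = (q%:Z + 2)%:~R :> rat)%R by rewrite -addn2.
    by rewrite ler_int -Num.Theory.lerBlDr.
  move: le_q; rewrite Num.Theory.ler_pdivrMr ?Num.Theory.ltr0n //.
  by rewrite -GRing.natrM Num.Theory.ler_nat mulnC.
apply: star_number_max; apply: forces_star_lb => //.
move: hlt; rewrite Num.Theory.ltrBrDr.
(* Writing [k] and [n] as successors turns both rational differences into naturals and makes the
   denominator positive, so it can be cleared. *)
case: k hk k2 {force_star_number} => [|[|k]] // _ _; case: n hn => // n _.
rewrite -[n.+1]addn1 -[k.+2]addn1 !GRing.natrD !GRing.addrK.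
rewrite Num.Theory.ltr_pdivlMr ?Num.Theory.ltr0n //.
by rewrite -(GRing.natrD _ q 1) -GRing.natrM Num.Theory.ltr_nat !addn1.
Qed.
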